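(* Let $S$ be a semigroup, let $E$ be a set of idempotents of $S$, and assume that $S$ is a reduced $E$-Fountain semigroup which satisfies the congruence condition. Then $S$ satisfies the generalized right ample condition if and only if, for every $\alpha\in S$, the function $r_\alpha:\widetilde{\mathcal{L}}_E(\alpha^{+})\to\widetilde{\mathcal{L}}_E(\alpha^{\ast})$, $r_\alpha(x)=x\alpha$, is a homomorphism of partial left $S$-actions.
   Context: For a semigroup $S$ and a subset $E$ of idempotents of $S$, define equivalence relations on $S$: $a\,\widetilde{\mathcal{L}}_E\,b$ iff for all $e\in E$ ($ae=a\iff be=b$); $a\,\widetilde{\mathcal{R}}_E\,b$ iff for all $e\in E$ ($ea=a\iff eb=b$). $S$ is $E$-Fountain if every $\widetilde{\mathcal{L}}_E$-class and every $\widetilde{\mathcal{R}}_E$-class contains an element of $E$. It is reduced if moreover $ef=e\iff fe=e$ for all $e,f\in E$. In that case each $\widetilde{\mathcal{L}}_E$-class (resp. $\widetilde{\mathcal{R}}_E$-class) contains a unique element of $E$; the one in the $\widetilde{\mathcal{L}}_E$-class (resp. $\widetilde{\mathcal{R}}_E$-class) of $a\in S$ is denoted $a^{\ast}$ (resp. $a^{+}$). $S$ satisfies the congruence condition if $\widetilde{\mathcal{L}}_E$ is a right congruence and $\widetilde{\mathcal{R}}_E$ is a left congruence; equivalently $(ab)^{\ast}=(a^{\ast}b)^{\ast}$ and $(ab)^{+}=(ab^{+})^{+}$ for all $a,b\in S$. The generalized right ample condition (or identity) holds in $S$ if $\left(e\left(a(eaf)^{\ast}\right)^{+}\right)^{\ast}=\left(a(eaf)^{\ast}\right)^{+}$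 for all $a\in S$ and $e,f\in E$. A partial left $S$-action on a set $X$ is a semigroup homomorphism from $S$ to the monoid of partial functions on $X$ (composed right to left); write $s\cdot x$ for the (possibly undefined) result. A function $f:X\to Y$ between partial left $S$-actions is a homomorphism if for all $x\in X$, $s\in S$: $s\cdot x$ is defined iff $s\cdot f(x)$ is defined, and in that case $f(s\cdot x)=s\cdot f(x)$. For $e\in E$, $\widetilde{\mathcal{L}}_E(e)$ is the $\widetilde{\mathcal{L}}_E$-class of $e$, i.e. $\{x\in S: x^{\ast}=e\}$; it is a partial left $S$-action via $s\cdot x=sx$ if $sx\in\widetilde{\mathcal{L}}_E(e)$, and $s\cdot x$ undefined otherwise. Under the congruence condition, $r_\alpha$ is a well-defined function $\widetilde{\mathcal{L}}_E(\alpha^{+})\to\widetilde{\mathcal{L}}_E(\alpha^{\ast})$. *)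

(* Defs.v *)
From mathcomp Require Import all_boot.
From mathcomp Require Import boolp classical_sets.

Set Implicit Arguments.
Unset Strict Implicit.
Unset Printing Implicit Defensive.

Local Open Scope classical_set_scope.
Local Open Scope group_scope.

Section EFountain.
Variables (S : semigroupType) (E : set S).

Definition Ltilde (a b : S) : Prop := forall e, E e -> (a * e = a <-> b * e = b).

Definition Rtilde (a b : S) : Prop := forall e, E e -> (e * a = a <-> e * b = b).

Definition Lclass (a : S) : set S := [set x | Ltilde x a].

Definition Rclass (a : S) : set S := [set x | Rtilde x a].

Definition E_Fountain : Prop :=
  (forall a, (Lclass a `&` E) !=set0) /\ (forall a, (Rclass a `&` E) !=set0).

Definition reduced_E_Fountain : Prop :=
  E_Fountain /\ (forall e f, E e -> E f -> (e * f = e <-> f * e = e)).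

Definition congruence_condition : Prop :=
  (forall a b c, Ltilde a b -> Ltilde (a * c) (b * c)) /\
  (forall a b c, Rtilde a b -> Rtilde (c * a) (c * b)).

(* [xget a] returns [a] when the set is empty; [star_unique] and [plus_unique]
   show that in a reduced E-Fountain semigroup [star a] and [plus a] are the
   unique elements of [E] in the classes of [a]. *)
Definition star (a : S) : S := xget a (Lclass a `&` E).

Definition plus (a : S) : S := xget a (Rclass a `&` E).

Definition generalized_right_ample : Prop :=
  forall a e f, E e -> E f ->
    star (e * plus (a * star (e * a * f))) = plus (a * star (e * a * f)).

Lemma starP : reduced_E_Fountain -> forall a, (Lclass a `&` E) (star a).
Proof. by move=> [[HL _] _] a; have [e He] := HL a; apply: xgetPex; exists e. Qed.

Lemma plusP : reduced_E_Fountain -> forall a, (Rclass a `&` E) (plus a).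
Proof. by move=> [[_ HR] _] a; have [e He] := HR a; apply: xgetPex; exists e. Qed.

Lemma star_unique (idemE : forall e, E e -> e * e = e)
  (redE : reduced_E_Fountain) a e : (Lclass a `&` E) e -> e = star a.
Proof.
have [Lf Ef] := starP redE a; case=> Le Ee; have [_ red] := redE.
have ef : e * star a = e by apply/(Le _ Ef)/(Lf _ Ef); exact: idemE.
have fe : star a * e = star a by apply/(Lf _ Ee)/(Le _ Ee); exact: idemE.
by rewrite -fe; apply/esym/(red _ _ Ee Ef).
Qed.

Lemma plus_unique (idemE : forall e, E e -> e * e = e)
  (redE : reduced_E_Fountain) a e : (Rclass a `&` E) e -> e = plus a.
Proof.
have [Rf Ef] := plusP redE a; case=> Re Ee; have [_ red] := redE.
have fe : plus a * e = e by apply/(Re _ Ef)/(Rf _ Ef); exact: idemE.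
have ef : e * plus a = plus a by apply/(Rf _ Ee)/(Re _ Ee); exact: idemE.
by rewrite -ef; apply/esym/(red _ _ Ee Ef).
Qed.

End EFountain.

Record partial_action (S : semigroupType) (X : Type) := PartialAction {
  pact :> S -> X -> option X;
  pactM : forall s t : S, pact (s * t) =1 pcomp (pact s) (pact t) }.

Definition partial_action_hom (S : semigroupType) (X Y : Type)
    (actX : partial_action S X) (actY : partial_action S Y) (f : X -> Y) : Prop :=
  forall x s, (isSome (actX s x) <-> isSome (actY s (f x))) /\
    (forall z, actX s x = Some z -> actY s (f x) = Some (f z)).

Section Lclass_action.
Variables (S : semigroupType) (E : set S).

Definition Lact_fun (e s : S) (x : set_type (Lclass E e)) :
  option (set_type (Lclass E e)) := insub (s * val x).

Lemma Lact_funM (e s t : S) :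
  @Lact_fun e (s * t) =1 pcomp (@Lact_fun e s) (@Lact_fun e t).
Proof.
move=> x; rewrite /pcomp /Lact_fun; case: (insubP _ (t * val x)) => [y _ yE|txN] /=.
  by rewrite yE mulgA.
case: insubP => // y /set_mem stxL _; exfalso; case/negP: txN.
have xL : Lclass E e (val x) by apply: set_mem; exact: valP.
apply/mem_set => f Ef; split=> [txf|ef].
  by apply/(stxL _ Ef); rewrite -(mulgA s t) -mulgA txf.
by rewrite -mulgA; congr (_ * _); apply/(xL _ Ef).
Qed.

Definition Lact (e : S) : partial_action S (set_type (Lclass E e)) :=
  PartialAction (@Lact_funM e).

Hypotheses (idemE : forall e, E e -> e * e = e)
  (redE : reduced_E_Fountain E) (congE : congruence_condition E).

Lemma rmul_subproof (a : S) (x : set_type (Lclass E (plus E a))) :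
  val x * a \in Lclass E (star E a).
Proof.
have xL : Lclass E (plus E a) (val x) by apply: set_mem; exact: valP.
have [Rp Ep] := plusP redE a; have [Ls _] := starP redE a.
have pa : plus E a * a = a by apply/(Rp _ Ep); exact: idemE.
apply/mem_set => f Ef; have := congE.1 _ _ a xL f Ef; rewrite pa.
by move=> ->; split=> /(Ls _ Ef).
Qed.

Definition rmul (a : S) (x : set_type (Lclass E (plus E a))) :
  set_type (Lclass E (star E a)) := Sub (val x * a) (rmul_subproof x).

End Lclass_action.

(* Main.v *)
Require Import Defs.
From mathcomp Require Import all_boot.
From mathcomp Require Import boolp classical_sets.
Local Open Scope group_scope.

(** Order [E] by [e <= f] when [e * f = e]; reducedness makes this relation
    left-right symmetric and hence antisymmetric, and [star a] (resp. [plus a])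
    is the least [e] in [E] with [a * e = a] (resp. [e * a = a]).

    Both sides of the equivalence say that cutting [a] down on the left by an
    idempotent strictly below [plus a] must change [star a]:

      if [e <= plus a] and [star (e * a) = star a], then [e = plus a].

    This is [restriction_rigid]; the theorem chains two equivalences.

    - Homomorphism ([rmul_homP]).  Since [plus a * a = a], right multiplication
      by [a] maps the class of [plus a] into that of [star a] and commutes with
      the action, so the only issue is the domain: [star (s * x * a) = star a]
      has to force [star (s * x) = plus a].  By the congruence condition
      [star (s * x * a)] depends only on the idempotent [star (s * x)], which
      is below [plus a]; all idempotents below [plus a] arise in this way, by
      taking [x = plus a].

    - Ample identity ([ampleP]).  For [e <= plus a], the identity with
      [f = star a] reads [e = plus a] as soon as [star (e * a) = star a].
      Conversely put [g = star (e * a * f)], [b = a * g] and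
      [k = star (e * plus b)].  Then [k <= plus b], and both [star (k * b)] and
      [star b] equal [g], so rigidity gives [k = plus b], which is the
      identity. *)

Section ReducedEFountain.
Variables (S : semigroupType) (E : set S).
Hypotheses (idemE : forall e, E e -> e * e = e).
Hypotheses (redE : reduced_E_Fountain E).

Lemma star_in a : E (star E a).
Proof. by have [] := starP redE a. Qed.

Lemma plus_in a : E (plus E a).
Proof. by have [] := plusP redE a. Qed.

Lemma mulg_starP a e : E e -> a * e = a <-> star E a * e = star E a.
Proof. by move=> Ee; have [La _] := starP redE a; exact: iff_sym (La _ Ee). Qed.

Lemma star_le a e : E e -> a * e = a -> star E a * e = star E a.
Proof. by move=> Ee /(mulg_starP a e Ee). Qed.

Lemma mulg_star a : a * star E a = a.
Proof. apply: (mulg_starP _ _ (star_in a)).2; exact/idemE/star_in. Qed.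

Lemma plus_mulg a : plus E a * a = a.
Proof. by have [Ra Ep] := plusP redE a; apply/(Ra _ Ep); exact: idemE. Qed.

Lemma star_idem {e} : E e -> star E e = e.
Proof. by move=> Ee; apply/esym/star_unique => //; split. Qed.

Lemma LtildeE a b : Ltilde E a b <-> star E a = star E b.
Proof.
split=> [ab|ab e Ee].
  apply: star_unique => //; split; last exact: star_in.
  by have [La _] := starP redE a; move=> e Ee;
     exact: iff_trans (La e Ee) (ab e Ee).
apply: iff_trans (mulg_starP a e Ee) _; rewrite ab.
exact: iff_sym (mulg_starP b e Ee).
Qed.

Lemma le_swap {e f} : E e -> E f -> e * f = e -> f * e = e.
Proof. by move=> Ee Ef /(redE.2 _ _ Ee Ef). Qed.

Lemma le_antisym {e f} : E e -> E f -> e * f = e -> f * e = f -> e = f.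
Proof. by move=> Ee Ef ef <-; rewrite (le_swap Ee Ef ef). Qed.

Definition restriction_rigid : Prop :=
  forall a e, E e -> e * plus E a = e -> star E (e * a) = star E a ->
    e = plus E a.

Hypothesis (congE : congruence_condition E).

Lemma star_mul a b : star E (star E a * b) = star E (a * b).
Proof. by apply/LtildeE/congE.1/LtildeE/star_idem/star_in. Qed.

Lemma ampleP : generalized_right_ample E <-> restriction_rigid.
Proof.
split=> [ample a e Ee ep eas|rigid a e f Ee Ef].
  have := ample a e (star E a) Ee (star_in a).
  by rewrite -mulgA mulg_star eas mulg_star ep (star_idem Ee).
set g := star E (e * a * f); set b := a * g.
have Eg : E g by exact: star_in.
have bg : b * g = b by rewrite /b -mulgA idemE.
have fg : f * g = g.
  apply: le_swap => //; apply: star_le => //.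
  by rewrite -mulgA (idemE _ Ef).
have ebE : e * b = e * a * f.
  by rewrite -[RHS]mulg_star -/g -mulgA fg /b mulgA.
(* [g <= star b] because [b * star b = b] can be multiplied by [e] on the left;
   the reverse inequality is [bg]. *)
have star_b : star E b = g.
  apply: le_antisym => //; first exact: star_in.
    exact: star_le.
  apply: star_le; first exact: star_in.
  by rewrite -ebE -mulgA mulg_star.
apply: rigid; first exact: star_in.
  apply: star_le; first exact: plus_in.
  by rewrite -mulgA idemE //; exact: plus_in.
by rewrite star_mul -mulgA plus_mulg ebE star_b.
Qed.

Lemma Lact_isSome e s (x : set_type (Lclass E e)) :
  isSome (Lact E e s x) <-> star E (s * val x) = star E e.
Proof.
rewrite -LtildeE /= /Lact_fun isSome_insub.
by split=> [/set_mem|/mem_set].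
Qed.

(** Compatibility of [rmul a] with the action is associativity, and
    [star (s * x) = plus a] gives [star (s * x * a) = star (plus a * a) = star a]
    by the congruence condition; only the converse implication is a constraint. *)
Lemma rmul_hom_domP a :
  partial_action_hom (Lact E (plus E a)) (Lact E (star E a))
    (@rmul S E idemE redE congE a) <->
  (forall s x, star E x = plus E a ->
     star E (s * x * a) = star E a -> star E (s * x) = plus E a).
Proof.
have sp : star E (plus E a) = plus E a := star_idem (plus_in a).
have ss : star E (star E a) = star E a := star_idem (star_in a).
split=> [hom s x xp sxa|dom x s].
  have xL : x \in Lclass E (plus E a) by apply/mem_set/LtildeE; rewrite xp sp.
  have [[_ +] _] := hom (Sub x xL) s.
  by rewrite !Lact_isSome /= sp ss mulgA; apply.
have xp : star E (val x) = plus E a.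
  by rewrite -[RHS]sp; apply/LtildeE/(set_mem (valP x)).
split=> [|z].
  rewrite !Lact_isSome /= sp ss mulgA; split=> [sx|]; last exact: dom.
  by rewrite -star_mul sx plus_mulg.
rewrite /= /Lact_fun; case: insubP => // y _ yE [<-].
have -> : s * val (rmul idemE redE congE x) =
    val (rmul idemE redE congE y) by rewrite /= yE mulgA.
exact: valK.
Qed.

Lemma rmul_homP :
  restriction_rigid <->
  (forall a : S,
     partial_action_hom (Lact E (plus E a)) (Lact E (star E a))
       (@rmul S E idemE redE congE a)).
Proof.
split=> [rigid a|hom a e Ee ep ea].
  apply/rmul_hom_domP => s x xp sxa; apply: rigid; first exact: star_in.
    apply: star_le; first exact: plus_in.
    by rewrite -mulgA -{1}xp mulg_star.
  by rewrite star_mul.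
have /rmul_hom_domP /(_ e (plus E a) (star_idem (plus_in a))) := hom a.
by rewrite ep (star_idem Ee); apply.
Qed.

End ReducedEFountain.

Theorem theorem3p6 (S : semigroupType) (E : set S)
    (idemE : forall e, E e -> e * e = e)
    (redE : reduced_E_Fountain E) (congE : congruence_condition E) :
  generalized_right_ample E <->
  (forall a : S,
     partial_action_hom (Lact E (plus E a)) (Lact E (star E a))
       (@rmul S E idemE redE congE a)).
Proof. exact: iff_trans (ampleP S E idemE redE congE) (rmul_homP S E _ _ _). Qed.
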